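(* Let $K\subset\mathbb{R}^2$ be a compact set which is intervally thin in two different (i.e. linearly independent) directions $v_1,v_2\in S^1$. Assume that for a dense set of line segments $L\subset\mathbb{R}^2$ the set $K\cap L$ is at most countable. Then $K$ is $c$-removable.
   Context: $B(x,\varepsilon)$ is the open Euclidean ball with centre $x$ and radius $\varepsilon$; $[x,y]$ is the line segment with endpoints $x,y\in\mathbb{R}^d$; $S^{d-1}$ is the unit sphere in $\mathbb{R}^d$. A set $A\subset\mathbb{R}^d$ is intervally thin in direction $v\in S^{d-1}$ if for any $x,y\in\mathbb{R}^d$ with $x-y$ parallel to $v$, and any $\varepsilon>0$, there exist $x'\in B(x,\varepsilon)$ and $y'\in B(y,\varepsilon)$ such that $[x',y']\cap A=\emptyset$. ''For a dense set of line segments $L$, $K\cap L$ is at most countable'' means: for all $x,y\in\mathbb{R}^2$ and all $\varepsilon>0$ there exist $x'\in B(x,\varepsilon)$ and $y'\in B(y,\varepsilon)$ such that $K\cap[x',y']$ is at most countable. For $U\subset\mathbb{R}^d$ open, a function $f:U\to\mathbb{R}$ is locally convex on $U$ if every point of $U$ has an open convex neighbourhood $V\subset U$ such that $f|_V$ is convex. A closed set $A\subset\mathbb{R}^d$ is $c$-removable if every function $f:\mathbb{R}^d\to\mathbb{R}$ which is continuous on $\mathbb{R}^d$ and locally convex on $\mathbb{R}^d\setminus A$ is convex on $\mathbb{R}^d$. *)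

(* Defs.v *)
From HB Require Import structures.
From mathcomp Require Import all_boot all_order all_algebra.
From mathcomp Require Import all_classical all_reals all_analysis.

Set Implicit Arguments.
Unset Strict Implicit.
Unset Printing Implicit Defensive.

Import Order.TTheory GRing.Theory Num.Theory.
Import numFieldNormedType.Exports.

Local Open Scope classical_set_scope.
Local Open Scope ring_scope.

(* The library norm on ['rV[R]_d] is the sup norm, hence a separate Euclidean
   norm. Both define the same topology (see [open_eballP]), so [open],
   [closed], [compact] and [continuous] below are the library notions. *)
Definition enorm (R : realType) (d : nat) (x : 'rV[R]_d) : R :=
  Num.sqrt (\sum_(i < d) x 0 i ^+ 2).

Definition eball (R : realType) (d : nat) (x : 'rV[R]_d) (e : R) :
    set 'rV[R]_d :=
  [set y | enorm (y - x) < e].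

Definition esphere (R : realType) (d : nat) : set 'rV[R]_d :=
  [set v | enorm v = 1].
Arguments esphere : clear implicits.

Definition segment (R : realType) (d : nat) (x y : 'rV[R]_d) :
    set 'rV[R]_d :=
  [set (1 - t) *: x + t *: y | t in `[0, 1]].

(* [x - y = t *: v] with [t = 0] allowed: the zero vector counts as parallel
   to [v]. For nonzero [v] this does not change the notion, since the case
   [x = y] follows from the case [y = x + t *: v] with [t] small. *)
Definition intervally_thin (R : realType) (d : nat) (v : 'rV[R]_d)
    (A : set 'rV[R]_d) : Prop :=
  forall x y : 'rV[R]_d, (exists t : R, x - y = t *: v) ->
  forall e : R, 0 < e ->
  exists x' y' : 'rV[R]_d,
    [/\ eball x e x', eball y e y' & segment x' y' `&` A = set0].

(* [countable] means at most countable. *)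
Definition countable_on_dense_segments (R : realType) (d : nat)
    (K : set 'rV[R]_d) : Prop :=
  forall (x y : 'rV[R]_d) (e : R), 0 < e ->
  exists x' y' : 'rV[R]_d,
    [/\ eball x e x', eball y e y' & countable (K `&` segment x' y')].

(* [f] is total, but only its values on [U] matter. Openness of [U] is not
   assumed separately because it follows from the existence of the [V]s. *)
Definition locally_convex_on (R : realType) (d : nat) (U : set 'rV[R]_d)
    (f : 'rV[R]_d -> R) : Prop :=
  forall x : 'rV[R]_d, U x ->
  exists V : set 'rV[R]_d,
    [/\ open V, convex_set V, V x, V `<=` U & convex_function V f].

Definition c_removable (R : realType) (d : nat) (A : set 'rV[R]_d) : Prop :=
  closed A /\
  forall f : 'rV[R]_d -> R,
    continuous f -> locally_convex_on (~` A) f -> convex_function setT f.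

Lemma ler_coord_enorm (R : realType) (d : nat) (x : 'rV[R]_d) (i : 'I_d) :
  `|x 0 i| <= enorm x.
Proof.
rewrite -sqrtr_sqr /enorm ler_wsqrtr// (bigD1 i)//= lerDl.
by apply: sumr_ge0 => j _; exact: sqr_ge0.
Qed.

Lemma ltr_enorm (R : realType) (d : nat) (x : 'rV[R]_d) (e : R) : 0 < e ->
  (forall i, `|x 0 i| < e) -> enorm x < d.+1%:R * e.
Proof.
move=> e0 xe; have h0 : 0 <= d.+1%:R * e by rewrite mulr_ge0 ?ler0n// ltW.
rewrite -[ltRHS]ger0_norm// -sqrtr_sqr /enorm ltr_sqrt; last first.
  by rewrite exprn_gt0// mulr_gt0.
apply: (@le_lt_trans _ _ (\sum_(i < d) e ^+ 2)).
  apply: ler_sum => i _; rewrite -real_normK ?num_real//.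
  by rewrite lerXn2r ?nnegrE// ltW.
rewrite sumr_const card_ord -[ltLHS]mulr_natl exprMn ltr_pM2r ?exprn_gt0//.
by rewrite -natrX ltr_nat (leq_trans (ltnSn d))// -[leqLHS]expn1 leq_pexp2l.
Qed.

Lemma open_eballP (R : realType) (d : nat) (U : set 'rV[R]_d) :
  open U <-> forall x, U x -> exists2 e : R, 0 < e & eball x e `<=` U.
Proof.
split=> [oU x Ux|h].
  have /nbhs_ballP[e /= e0 eU] : nbhs x U by exact: open_nbhs_nbhs.
  exists e => // y yx; apply: eU; rewrite /ball/=.
  split=> // i j; rewrite ord1 /ball/= distrC.
  by have := ler_coord_enorm (y - x) j; rewrite !mxE => /le_lt_trans; apply.
rewrite openE => x /h[e e0 eU]; apply/nbhs_ballP.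
have d0 : 0 < e / d.+1%:R by rewrite divr_gt0.
exists (e / d.+1%:R) => //= y xy; apply: eU; rewrite /eball/=.
have -> : e = d.+1%:R * (e / d.+1%:R) by rewrite mulrC divfK.
apply: ltr_enorm => // i; rewrite !mxE distrC.
by case: xy => _ /(_ 0 i).
Qed.

(* Main.v *)
Require Import Defs.
From HB Require Import structures.
From mathcomp Require Import all_boot all_order all_algebra.
From mathcomp Require Import all_classical all_reals all_analysis.
From mathcomp Require Import ring lra.

Set Implicit Arguments.
Unset Strict Implicit.
Unset Printing Implicit Defensive.

Import Order.TTheory GRing.Theory Num.Theory.
Import numFieldNormedType.Exports.

Local Open Scope classical_set_scope.
Local Open Scope ring_scope.

(** Let [f] be continuous and locally convex off [K]. Convexity on a segment is
    preserved by limits of segments ([chord_bounded_limit]), so it is enough to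
    prove it on segments arbitrarily close to a given one.

    In the directions [v1] and [v2] this is immediate: the nearby segments that
    miss [K] carry locally convex, hence convex, restrictions of [f]
    ([chord_bounded_thin]).

    In a general direction, take a nearby segment that meets [K] in a countable
    set. On it, [f] restricts to a function [g] of one variable that is
    continuous and locally convex off a countable set. Such a function can fail
    to be convex only if it has a concave kink, i.e. a point where its graph
    lies below two lines of different slopes through that point. Indeed, if [g]
    rises above one of its chords, then for every [m] in an open interval of
    slopes [g t - m * t] has an interior maximum. Its leftmost maximum point is
    not a point of local convexity, so it lies in the countable set; and if two
    slopes shared that point, it would be a concave kink
    ([chord_bounded_countable]).

    What remains is that convexity in two directions excludes concave kinks in
    every direction spanned by them ([no_concave_kink]). Move the point to the
    origin, assume [f 0 = 0], and rescale [v1], [v2] so that the direction is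
    [v1 + v2]. Write [F p q] for [f] at [p v1 + q v2], and let [al] and [be] be
    the one-sided derivatives of [f] at [0] in the directions [v1] and [- v2].
    If [F h h <= m * h] for small [h > 0], convexity between [(h, h)] and
    [(h, - s)] at [(h, 0)] gives
      [(h + s) * al <= s * m + F h (- s)],
    and [h -> 0] yields [al - m <= F 0 (- s) / s] for every [s > 0]; hence
    [al - m <= be]. Likewise [F (- h) (- h) <= - m' * h] yields
    [be + m' <= al]. Together, [m' <= m]. *)

(** * Convexity on a segment and concave kinks *)

Definition chord_bounded (R : realType) (E : lmodType R) (f : E -> R)
    (x y : E) : Prop :=
  forall t : R, 0 <= t <= 1 ->
  f ((1 - t) *: x + t *: y) <= (1 - t) * f x + t * f y.

(** When [g s <= g t + m * (s - t)] and [g s <= g t + m' * (s - t)] near [t]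
    with [m < m'], the larger slope binds on the left and the smaller one on
    the right: the graph has an angle at [t] that points upwards. *)
Definition concave_kink (R : realType) (g : R -> R) (t : R) : Prop :=
  exists m m' r : R, [/\ m < m', 0 < r &
    forall s, `|s| < r -> g (t + s) - g t <= m * s /\
                          g (t + s) - g t <= m' * s].

(** * Functions of one variable, locally convex off a countable set *)

Lemma countable_preimage_inj (T U : Type) (h : T -> U) (A : set T) (B : set U) :
  {in A &, injective h} -> (forall t, A t -> B (h t)) -> countable B ->
  countable A.
Proof.
move=> hinj hAB; apply: sub_countable.
have /card_eqPle[] := inj_card_eq hinj => _ /card_le_trans; apply.
by apply: subset_card_le => _ [t At <-]; exact: hAB.
Qed.

Lemma uncountable_itvoo (R : realType) (a b : R) :
  a < b -> ~ countable (`]a, b[%classic : set R).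
Proof.
move=> ab /countable_lebesgue_measure0 /eqP.
rewrite lebesgue_measure_itv/= lte_fin ab -EFinD eqe subr_eq0 => /eqP ba.
by rewrite ba ltxx in ab.
Qed.

(** The leftmost maximum point is the useful one because [h] cannot be convex
    around it: at points slightly to its left [h] is strictly smaller, and at
    points to its right it is no larger. *)
Lemma leftmost_maximum (R : realType) (h : R -> R) (t0 : R) :
  continuous h -> 0 <= t0 <= 1 -> h 0 < h t0 -> h 1 < h t0 ->
  exists t, [/\ 0 < t < 1, forall s, 0 <= s <= 1 -> h s <= h t &
    forall s, 0 <= s < t -> h s < h t].
Proof.
move=> hc t01 h0 h1.
have [c c01 hmax] : exists2 c, c \in `[0, 1]%R &
    forall t, t \in `[0, 1]%R -> h t <= h c.
  by apply: EVT_max => //; exact: continuous_subspaceT.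
pose T := `[0, 1]%classic `&` h @^-1` [set y | h c <= y].
have Tcompact : compact T.
  apply: compact_closedI; first exact: segment_compact.
  by apply: preimage_closed => [? _|]; [exact: hc|exact: closed_ge].
have [t] := @compact_EVT_min _ _ idfun T (ex_intro _ c (conj c01 (lexx _)))
  Tcompact (@continuous_subspaceT _ _ T _ (fun=> cvg_id)).
rewrite inE => -[/= t01' hct] tmin.
have htc : h t = h c by apply/eqP; rewrite eq_le hct hmax.
have ht0 : h t0 <= h t by rewrite htc; apply: hmax; rewrite in_itv.
exists t; split.
- move: t01'; rewrite in_itv/= => /andP[t_ge0 t_le1].
  rewrite !lt_neqAle t_ge0 t_le1 !andbT; apply/andP; split.
    by apply/eqP => t_eq; move: h0; rewrite t_eq ltNge ht0.
  by apply/eqP => t_eq; move: h1; rewrite -t_eq ltNge ht0.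
- by move=> s s01; rewrite htc; apply: hmax; rewrite in_itv.
- move=> s /andP[s0 st]; rewrite htc ltNge; apply/negP => hcs.
  have : t <= s.
    apply: tmin; rewrite inE; split => //=.
    move: t01'; rewrite !in_itv/= s0 => /andP[_]; apply: le_trans.
    exact: ltW.
  by rewrite leNgt st.
Qed.

(** For each slope [m] close to that of the chord, the leftmost maximum point of
    [g t - m * t] must lie in [E]. Without concave kinks these points are
    different for different [m], which would inject an interval into [E]. *)
Lemma chord_bounded_countable (R : realType) (g : R -> R) (E : set R) :
  continuous g -> countable E ->
  (forall t, 0 < t < 1 -> ~ E t -> exists2 r, 0 < r &
     forall s, 0 < s < r -> 2 * g t <= g (t - s) + g (t + s)) ->
  (forall t, E t -> ~ concave_kink g t) ->
  chord_bounded (g : R^o -> R) 0 1.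
Proof.
move=> gc Ecnt gloc Enokink t0 t001; rewrite leNgt; apply/negP.
rewrite scaler0 add0r /GRing.scale/= mulr1 => gt0.
(* [m0] is the slope of the chord and [eta] the height of the graph above the
   chord at [t0]; for [m] within [eta] of [m0], [g t - m * t] is still larger
   at [t0] than at both end points. *)
pose m0 := g 1 - g 0; pose eta := g t0 - g 0 - t0 * m0.
have eta0 : 0 < eta by rewrite /eta /m0; lra.
have /andP[t0ge t0le] := t001.
have tn0 : t0 != 0 by apply/eqP => t0E; move: gt0; rewrite t0E; lra.
have tn1 : t0 != 1 by apply/eqP => t0E; move: gt0; rewrite t0E; lra.
have choose_t m : `]m0 - eta, m0 + eta[%classic m ->
    exists t, [/\ E t, 0 < t < 1 &
      forall s, 0 <= s <= 1 -> g s - m * s <= g t - m * t].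
  rewrite /= in_itv/= => /andP[m1 m2].
  have hc : continuous (fun t => g t - m * t).
    move=> t; apply: cvgB; first exact: gc.
    by apply: cvgM; [exact: cvg_cst|exact: cvg_id].
  have [||t [t01 tmax tleft]] := leftmost_maximum hc t001.
  - have : t0 * (m - m0) < eta.
      have := ler_piMl (ltW eta0) t0le.
      apply: lt_le_trans; rewrite ltr_pM2l ?ltrBlDl// lt_neqAle eq_sym tn0//.
    by rewrite /eta /m0; lra.
  - have : (1 - t0) * (m0 - m) < eta.
      have t0le1 : 1 - t0 <= 1 by lra.
      have := ler_piMl (ltW eta0) t0le1.
      apply: lt_le_trans; rewrite ltr_pM2l ?subr_gt0 ?lt_neqAle ?tn1//; lra.
    by rewrite /eta /m0; lra.
  exists t; split => //; apply: contrapT => nEt.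
  have [r r0 gr] := gloc t t01 nEt.
  have [s [s0 sr st st1]] : exists s, [/\ 0 < s, s < r, s <= t & s <= 1 - t].
    have /andP[t_gt0 t_lt1] := t01.
    exists (Num.min (r / 2) (Num.min t (1 - t))); split.
    - by rewrite !lt_min divr_gt0// t_gt0 subr_gt0.
    - by rewrite gt_min ltr_pdivrMr// ltr_pMr// ltr1n.
    - by rewrite !ge_min lexx orbT.
    - by rewrite !ge_min lexx !orbT.
  have /andP[t_gt0 t_lt1] := t01.
  have a1 : g (t - s) - m * (t - s) < g t - m * t.
    by apply: tleft; apply/andP; split; lra.
  have a2 : g (t + s) - m * (t + s) <= g t - m * t.
    by apply: tmax; apply/andP; split; lra.
  have a3 : 2 * g t <= g (t - s) + g (t + s) by apply: gr; rewrite s0.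
  lra.
pose tau m := if pselect (`]m0 - eta, m0 + eta[%classic m) is left mP
              then projT1 (cid (choose_t m mP)) else 0.
have tauP m : `]m0 - eta, m0 + eta[%classic m -> [/\ E (tau m), 0 < tau m < 1 &
      forall s, 0 <= s <= 1 -> g s - m * s <= g (tau m) - m * tau m].
  by rewrite /tau; case: pselect => // mP _; case: cid.
suff /uncountable_itvoo : countable (`]m0 - eta, m0 + eta[%classic : set R).
  by apply; lra.
apply: (countable_preimage_inj (h := tau) (B := E)) => //; last first.
  by move=> m /tauP[].
have slope_inj m m' : `]m0 - eta, m0 + eta[%classic m ->
    `]m0 - eta, m0 + eta[%classic m' -> tau m = tau m' -> ~ m < m'.
  move=> /tauP[Et t01 mP] /tauP[_ _ m'P] tt mm'; rewrite -tt in m'P.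
  have /andP[t_gt0 t_lt1] := t01.
  apply: (Enokink _ Et).
  exists m, m', (Num.min (tau m) (1 - tau m)); split => //.
    by rewrite lt_min t_gt0 subr_gt0.
  move=> s; rewrite lt_min !ltr_norml => /andP[/andP[? ?] /andP[? ?]].
  have s01 : 0 <= tau m + s <= 1 by apply/andP; split; lra.
  by have := mP _ s01; have := m'P _ s01; split; lra.
move=> m m' /set_mem mP /set_mem m'P tt.
by have [] := ltgtP m m' => // /slope_inj; [case|move=> /(_ m'P mP); case].
Qed.

(** * Convexity in two directions excludes concave kinks *)

Lemma chord_bounded_at0 (R : realType) (g : R^o -> R) (h s : R) :
  0 < h -> 0 < s -> chord_bounded g h (- s) ->
  (h + s) * g 0 <= s * g h + h * g (- s).
Proof.
move=> h0 s0 gb; have hs0 : 0 < h + s by rewrite addr_gt0.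
have hsn0 : h + s != 0 by rewrite gt_eqF.
have /gb : 0 <= h / (h + s) <= 1.
  by rewrite ler_pdivrMr// mul1r lerDl (ltW s0) divr_ge0// ltW.
rewrite /GRing.scale/=.
have -> : (1 - h / (h + s)) * h + h / (h + s) * - s = 0 by field.
rewrite -(ler_pM2l hs0) => /le_trans; apply; rewrite le_eqVlt; apply/orP; left.
by apply/eqP; field.
Qed.

(** The number [a] is the right derivative of [g] at [0], which for a convex
    [g] is the infimum of the slopes [g h / h]; being the greatest lower bound
    is the property that lets two such derivatives be compared. *)
Lemma chord_bounded_right_slope (R : realType) (g : R^o -> R) :
  g 0 = 0 -> (forall x y, chord_bounded g x y) ->
  exists a : R, (forall h, 0 < h -> a * h <= g h) /\
    forall c, (forall h, 0 < h -> c * h <= g h) -> c <= a.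
Proof.
move=> g0 gb; pose S := [set g h / h | h in [set h : R | 0 < h]].
have S0 : S !=set0 by exists (g 1 / 1); exists 1 => //=.
have Slb : has_lbound S.
  exists (- g (- 1)) => _ [h /= h0 <-]; rewrite ler_pdivlMr//.
  by have := chord_bounded_at0 h0 ltr01 (gb _ _); rewrite g0; lra.
exists (inf S); split=> [h h0|c ch].
  by rewrite -ler_pdivlMr//; apply: ge_inf => //; exists h.
by apply: lb_le_inf => // _ [h /= h0 <-]; rewrite ler_pdivlMr// ch.
Qed.

(** Convexity on the vertical line through [(h, 0)] compares the three values
    [F h h], [F h 0] and [F h (- s)]; letting [h] tend to [0] turns the last one
    into [F 0 (- s)] and keeps only the growth rates of the other two. *)
Lemma slope_le_diagonal (R : realType) (F : R -> R -> R) (a m r s : R) :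
  (forall h x y, chord_bounded (F h : R^o -> R) x y) ->
  {for 0, continuous (fun h => F h (- s))} ->
  (forall h, 0 < h -> a * h <= F h 0) ->
  0 < r -> (forall h, 0 < h < r -> F h h <= m * h) ->
  0 < s -> (a - m) * s <= F 0 (- s).
Proof.
move=> Fb Fc Fa r0 Fm s0; rewrite -subr_ge0.
apply: (@cvgr_to_ge _ 0^'+ _ _ (fun h => F h (- s) - ((a - m) * s + h * a))).
  apply: cvgB; first exact: cvg_at_right_filter.
  rewrite -[X in _ --> X]addr0 -[X in _ --> _ + X](mul0r a).
  apply: cvg_at_right_filter; apply: cvgD; first exact: cvg_cst.
  by apply: cvgM; [exact: cvg_id|exact: cvg_cst].
near=> h; have h0 : 0 < h by near: h; exact: nbhs_right_gt.
have hr : h < r by near: h; exact: nbhs_right_lt.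
have b1 := chord_bounded_at0 h0 s0 (Fb h _ _).
have b2 : (h + s) * (a * h) <= (h + s) * F h 0.
  by rewrite ler_pM2l ?addr_gt0// Fa.
have b3 : s * F h h <= s * (m * h) by rewrite ler_pM2l// Fm// h0.
rewrite -(ler_pM2l h0) mulr0; lra.
Unshelve. all: by end_near. Qed.

Lemma chord_bounded_line (R : realType) (V : lmodType R) (f : V -> R)
    (v p : V) (b k : R) :
  (forall y c, chord_bounded f y (y + c *: v)) ->
  forall x y,
    chord_bounded ((fun q => f (p + q *: (b *: v)) - k) : R^o -> R) x y.
Proof.
move=> fv x y t t01.
have := fv (p + x *: (b *: v)) ((y - x) * b) t t01.
have -> : p + x *: (b *: v) + ((y - x) * b) *: v = p + y *: (b *: v).
  by rewrite -addrA -scalerA -scalerDl [x + _]addrC subrK.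
have -> : (1 - t) *: (p + x *: (b *: v)) + t *: (p + y *: (b *: v)) =
    p + ((1 - t) *: (x : R^o) + t *: (y : R^o)) *: (b *: v).
  rewrite !scalerDr addrACA -scalerDl subrK scale1r; congr (_ + _).
  by rewrite [RHS]scalerDl !scalerA.
lra.
Qed.

(** Two uses of [slope_le_diagonal] at the kink: on its right-hand side with the
    axes [(a v1, b v2)], on its left-hand side with the axes
    [(- b v2, - a v1)]. They bound the slopes [al] along [a v1] and [be] along
    [- b v2] by each other and leave no room for [m < m']. *)
Lemma no_concave_kink (R : realType) (V : normedModType R) (f : V -> R)
    (v1 v2 : V) (a b : R) (x : V) (t : R) :
  continuous f ->
  (forall y c, chord_bounded f y (y + c *: v1)) ->
  (forall y c, chord_bounded f y (y + c *: v2)) ->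
  ~ concave_kink (fun s => f (x + s *: (a *: v1 + b *: v2))) t.
Proof.
move=> fc fv1 fv2 [m [m' [r [mm' r0 kink]]]].
set z := x + t *: (a *: v1 + b *: v2) in kink.
have Fc (w w' : V) (s : R) :
    {for 0, continuous (fun h : R => f (z + h *: w + s *: w') - f z)}.
  apply: cvgB; last exact: cvg_cst.
  apply: continuous_comp; last exact: fc.
  apply: cvgD; last exact: cvg_cst.
  by apply: cvgD; [exact: cvg_cst|apply: cvgZ; [exact: cvg_id|exact: cvg_cst]].
have fz (w : V) : f (z + 0 *: w) - f z = 0 by rewrite scale0r addr0 subrr.
have [al [alP almax]] := chord_bounded_right_slope (fz (a *: v1))
  (@chord_bounded_line _ _ _ _ z a (f z) fv1).
have [be [beP bemax]] := chord_bounded_right_slope (fz (- b *: v2))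
  (@chord_bounded_line _ _ _ _ z (- b) (f z) fv2).
have kinks s : `|s| < r ->
    f (z + s *: (a *: v1) + s *: (b *: v2)) - f z <= m * s /\
    f (z + s *: (a *: v1) + s *: (b *: v2)) - f z <= m' * s.
  by move=> /kink; rewrite scalerDl addrA -/z scalerDr addrA.
have le1 : al - m <= be.
  apply: bemax => s s0.
  pose F p q := f (z + p *: (a *: v1) + q *: (b *: v2)) - f z.
  have -> : f (z + s *: (- b *: v2)) - f z = F 0 (- s).
    by rewrite /F scale0r addr0 !scaleNr scalerN.
  apply: (@slope_le_diagonal _ F al m r s) => // [h||h h0|h /andP[h0 hr]].
  - exact: chord_bounded_line.
  - exact: Fc.
  - by rewrite /F scale0r addr0; exact: alP.
  - by have [] := kinks h; rewrite ?gtr0_norm.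
have le2 : be + m' <= al.
  apply: almax => s s0.
  pose F p q := f (z + p *: (- b *: v2) + q *: (- a *: v1)) - f z.
  have -> : f (z + s *: (a *: v1)) - f z = F 0 (- s).
    by rewrite /F scale0r addr0 !scaleNr scalerN opprK.
  rewrite -[m']opprK.
  apply: (@slope_le_diagonal _ F be (- m') r s) => // [h||h h0|h /andP[h0 hr]].
  - exact: chord_bounded_line.
  - exact: Fc.
  - by rewrite /F scale0r addr0; exact: beP.
  - have [|_] := kinks (- h); first by rewrite normrN gtr0_norm.
    by rewrite /F mulrN mulNr !scaleNr !scalerN addrAC.
lra.
Qed.

(** * Segments in a Euclidean space *)

Lemma chord_bounded_limit (R : realType) (d : nat) (f : 'rV[R]_d -> R)
    (x y : 'rV[R]_d) :
  continuous f ->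
  (forall e, 0 < e -> exists x' y',
     [/\ eball x e x', eball y e y' & chord_bounded f x' y']) ->
  chord_bounded f x y.
Proof.
move=> fc xy t t01; rewrite -subr_ge0 leNgt; apply/negP => gap.
pose G (z : 'rV[R]_d * 'rV[R]_d) :=
  (1 - t) * f z.1 + t * f z.2 - f ((1 - t) *: z.1 + t *: z.2).
have Gc : {for (x, y), continuous G}.
  have fst_c : (fun z : 'rV[R]_d * 'rV[R]_d => z.1) @ (x, y) --> x.
    exact: cvg_fst.
  have snd_c : (fun z : 'rV[R]_d * 'rV[R]_d => z.2) @ (x, y) --> y.
    exact: cvg_snd.
  apply: cvgB.
    apply: cvgD; apply: cvgM; try exact: cvg_cst.
      by apply: (cvg_comp _ _ fst_c); exact: fc.
    by apply: (cvg_comp _ _ snd_c); exact: fc.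
  apply: continuous_comp; last exact: fc.
  by apply: cvgD; apply: cvgZ => //; exact: cvg_cst.
have [[A B] /= [Ax By] AB] := cvgr_lt _ Gc _ gap.
have /open_eballP/(_ x)[|e1 e10 e1A] := open_interior A; first exact: Ax.
have /open_eballP/(_ y)[|e2 e20 e2B] := open_interior B; first exact: By.
have [|x' [y' [x'e y'e /(_ t t01)]]] := xy (Num.min e1 e2).
  by rewrite lt_min e10.
rewrite -subr_ge0 leNgt => /negP; apply.
apply: (AB (x', y')); split => /=; apply: interior_subset.
  by apply: e1A; move: x'e; rewrite /eball/= lt_min => /andP[].
by apply: e2B; move: y'e; rewrite /eball/= lt_min => /andP[].
Qed.

Lemma locally_convex_midpoint (R : realType) (d : nat) (U : set 'rV[R]_d)
    (f : 'rV[R]_d -> R) (x v : 'rV[R]_d) :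
  locally_convex_on U f -> U x ->
  exists2 r, 0 < r &
    forall s, 0 < s < r -> 2 * f x <= f (x - s *: v) + f (x + s *: v).
Proof.
move=> fU /fU[V [oV cV Vx _ fV]].
have line_c : {for 0, continuous (fun s : R => x + s *: v)}.
  by apply: cvgD; [exact: cvg_cst|apply: cvgZr_tmp].
have : \forall s \near (0 : R), V (x + s *: v).
  apply: line_c; rewrite scale0r addr0; exact: open_nbhs_nbhs.
move=> /nbhs_ballP[r /= r0 rV]; exists r => // s /andP[s0 sr].
have V1 : V (x - s *: v).
  by rewrite -scaleNr; apply: rV; rewrite /ball/= sub0r opprK gtr0_norm.
have V2 : V (x + s *: v).
  by apply: rV; rewrite /ball/= sub0r normrN gtr0_norm.
have half0 : 0 <= 2^-1 :> R by rewrite invr_ge0.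
have half1 : 2^-1 <= 1 :> R by rewrite invf_le1 ?ler1n.
have : f (2^-1 *: (x - s *: v) + (1 - 2^-1) *: (x + s *: v)) <=
    2^-1 * f (x - s *: v) + (1 - 2^-1) * f (x + s *: v).
  exact: (fV (Itv01 half0 half1) _ _ (mem_set V1) (mem_set V2)).
have -> : 1 - 2^-1 = 2^-1 :> R by field.
rewrite -scalerDr addrACA addNr addr0 -mulr2n -[x *+ 2]scaler_nat scalerA.
by rewrite mulVf// scale1r; lra.
Qed.

(** The kink condition is asked only at points of [K] on the segment, so that it
    is vacuous for a segment that misses [K]. *)
Lemma chord_bounded_segment (R : realType) (d : nat) (K : set 'rV[R]_d)
    (f : 'rV[R]_d -> R) (x y : 'rV[R]_d) :
  continuous f -> locally_convex_on (~` K) f -> countable (K `&` segment x y) ->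
  (forall t, segment x y (x + t *: (y - x)) -> K (x + t *: (y - x)) ->
     ~ concave_kink (fun s => f (x + s *: (y - x))) t) ->
  chord_bounded f x y.
Proof.
move=> fc fK Kcnt nokink.
have segE (t : R) : (1 - t) *: x + t *: y = x + t *: (y - x).
  by rewrite scalerBl scale1r scalerBr addrA addrAC.
have [<-|xy] := eqVneq x y.
  by move=> t _; rewrite -scalerDl -mulrDl subrK scale1r mul1r.
have seg t : 0 <= t <= 1 -> segment x y (x + t *: (y - x)).
  by move=> t01; exists t; rewrite ?in_itv//= segE.
pose E := [set t : R | 0 <= t <= 1 /\ K (x + t *: (y - x))].
have Ecnt : countable E.
  apply: (countable_preimage_inj (h := fun t => x + t *: (y - x)) _ _ Kcnt).
    move=> t t' _ _ /addrI /eqP; rewrite -subr_eq0 -scalerBl scaler_eq0.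
    rewrite [y - x == 0]subr_eq0 [y == x]eq_sym (negbTE xy) orbF subr_eq0.
    exact: eqP.
  by move=> t [t01 Kt]; split => //; exact: seg.
have gb : chord_bounded ((fun s => f (x + s *: (y - x))) : R^o -> R) 0 1.
  apply: chord_bounded_countable Ecnt _ _ => [t|t /andP[t0 t1] nEt|t [t01 Kt]].
  - apply: continuous_comp; last exact: fc.
    apply: cvgD; first exact: cvg_cst.
    by apply: cvgZ; [exact: cvg_id|exact: cvg_cst].
  - have [|r r0 rP] :=
        locally_convex_midpoint (x := x + t *: (y - x)) (y - x) fK.
      by move=> Kt; apply: nEt; split => //; rewrite !ltW.
    exists r => // s /rP; rewrite -!addrA -scalerBl -scalerDl; exact.
  - exact: nokink (seg _ t01) Kt.
move=> t /gb.
have -> : (1 - t) *: (0 : R^o) + t *: (1 : R^o) = t.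
  by rewrite scaler0 add0r; exact: mulr1.
by rewrite -segE scale0r addr0 scale1r [x + (y - x)]addrC subrK.
Qed.

Lemma chord_bounded_thin (R : realType) (d : nat) (K : set 'rV[R]_d)
    (f : 'rV[R]_d -> R) (v : 'rV[R]_d) :
  continuous f -> locally_convex_on (~` K) f -> intervally_thin v K ->
  forall y c, chord_bounded f y (y + c *: v).
Proof.
move=> fc fK thin y c; apply: chord_bounded_limit => // e e0.
have [|x' [y' [x'e y'e disj]]] := thin y (y + c *: v) _ e e0.
  by exists (- c); rewrite opprD addrA subrr add0r scaleNr.
exists x', y'; split => //; apply: chord_bounded_segment fc fK _ _.
  by rewrite setIC disj; exact: countable0.
move=> t segt Kt; suff : (segment x' y' `&` K) (x' + t *: (y' - x')).
  by rewrite disj.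
by [].
Qed.

(** * Removability *)

Lemma free_pair_decomp (F : fieldType) (v1 v2 u : 'rV[F]_2) :
  free [:: v1; v2] -> exists a b, u = a *: v1 + b *: v2.
Proof.
move=> vfree; have /andP[/eqP vspan _] : basis_of fullv [:: v1; v2].
  by rewrite basisEfree vfree subvf dimvf dim_matrix.
have : u \in <<[:: v1; v2]>>%VS by rewrite vspan memvf.
rewrite span_cons span_seq1 => /memv_addP[_ /vlineP[a ->] [_ /vlineP[b ->] ->]].
by exists a, b.
Qed.

Theorem proposition1 (R : realType) (K : set 'rV[R]_2) (v1 v2 : 'rV[R]_2) :
  compact K ->
  v1 \in esphere R 2 -> v2 \in esphere R 2 -> free [:: v1; v2] ->
  intervally_thin v1 K -> intervally_thin v2 K ->
  countable_on_dense_segments K ->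
  c_removable K.
Proof.
move=> Kcompact _ _ vfree thin1 thin2 Kcnt; split.
  by apply: compact_closed => //; exact: norm_hausdorff.
move=> f fc fK t y x _ _.
(* The parameter [t] weights the first end point in [convex_function] and the
   second one in [segment], so the end points are exchanged. *)
have : chord_bounded f x y.
  apply: chord_bounded_limit => // e e0.
  have [x' [y' [x'e y'e cnt]]] := Kcnt x y e e0.
  exists x', y'; split => //; apply: (chord_bounded_segment fc fK cnt).
  move=> s _ _; have [a [b ->]] := free_pair_decomp (y' - x') vfree.
  by apply: no_concave_kink => //; exact: (chord_bounded_thin fc fK).
move=> /(_ t%:num); rewrite ge0 le1 => /(_ isT).
by rewrite [X in f X <= _]addrC [X in _ <= X]addrC.
Qed.
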